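(* Let $q\in\mathbb{C}$, $q\neq0$. The comeasuring bialgebra $M(\mathbb{C}_q^2)$ of the quantum-braided plane is generated by $1$ and $s_{(i,j)}:=t^{(i,j)}{}_{(1,0)}$, $t_{(i,j)}:=t^{(i,j)}{}_{(0,1)}$ for $i,j\in\mathbb{Z}_+$, modulo the relations $$q\sum_{(a,b)+(c,d)=(i,j)}q^{bc}\,s_{(a,b)}t_{(c,d)}=\sum_{(a,b)+(c,d)=(i,j)}q^{bc}\,t_{(a,b)}s_{(c,d)}\qquad\forall i,j\in\mathbb{Z}_+ .$$ The coaction is given (formally) by $$x\mapsto\sum_{(i,j)}x^iy^j\otimes s_{(i,j)},\qquad y\mapsto\sum_{(i,j)}x^iy^j\otimes t_{(i,j)} .$$ The higher generators are given, for $k\ge1$ (and $l\geq 1$ in the last formula), by $$t^{(i,j)}{}_{(k,0)}=\sum_{(a_1,b_1)+\cdots+(a_k,b_k)=(i,j)}s_{(a_1,b_1)}\cdots s_{(a_k,b_k)}\,q^{\sum_{r=2}^k(b_1+\cdots+b_{r-1})a_r},$$ $$t^{(i,j)}{}_{(0,k)}=\sum_{(a_1,b_1)+\cdots+(a_k,b_k)=(i,j)}t_{(a_1,b_1)}\cdots t_{(a_k,b_k)}\,q^{\sum_{r=2}^k(b_1+\cdots+b_{r-1})a_r},$$ $$t^{(i,j)}{}_{(k,l)}=\sum_{(a,b)+(c,d)=(i,j)}q^{bc}\,t^{(a,b)}{}_{(k,0)}\,t^{(c,d)}{}_{(0,l)},$$ and hence determine the coalgebra structure $$\Delta s_{(i,j)}=\sum_{(a,b)}t^{(i,j)}{}_{(a,b)}\otimes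 s_{(a,b)},\quad \Delta t_{(i,j)}=\sum_{(a,b)}t^{(i,j)}{}_{(a,b)}\otimes t_{(a,b)},\quad \epsilon(s_{(i,j)})=\delta^i_1\delta^j_0,\quad \epsilon(t_{(i,j)})=\delta^i_0\delta^j_1 .$$ All indices range over $\mathbb{Z}_+$.
   Context: $\mathbb{Z}_+=\{0,1,2,\dots\}$. The quantum-braided plane $\mathbb{C}_q^2$ is the unital associative algebra over $\mathbb{C}$ generated by $x,y$ with $yx=qxy$. It has basis $e_{(m,n)}=x^my^n$, $m,n\in\mathbb{Z}_+$, with $e_{(i,j)}e_{(k,l)}=q^{jk}e_{(i+k,j+l)}$. Its comeasuring bialgebra $M(\mathbb{C}_q^2)$ is the unital associative algebra generated by symbols $t^{(m,n)}{}_{(i,j)}$, $m,n,i,j\in\mathbb{Z}_+$, with relations $$\sum_{(a,b)+(c,d)=(m,n)}q^{bc}\,t^{(a,b)}{}_{(i,j)}\,t^{(c,d)}{}_{(k,l)}=q^{jk}\,t^{(m,n)}{}_{(i+k,j+l)}$$ for all indices, together with $t^{(0,0)}{}_{(0,0)}=1$ and $t^{(m,n)}{}_{(0,0)}=0$ for $(m,n)\ne(0,0)$. Its coproduct is the matrix coproduct $\Delta t^{I}{}_{J}=\sum_K t^{I}{}_{K}\otimes t^{K}{}_{J}$, its counit is $\epsilon(t^I{}_J)=\delta^I{}_J$ and its coaction on $\mathbb{C}_q^2$ is $e_J\mapsto\sum_I e_I\otimes t^I{}_J$, where $I,J,K\in\mathbb{Z}_+\times\mathbb{Z}_+$. Since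 $\mathbb{C}_q^2$ is infinite-dimensional, infinite sums in the coproduct and coaction are understood formally (in a suitable completion of the tensor product). *)

(* Defs.v *)
From HB Require Import structures.
From mathcomp Require Import all_boot all_order all_algebra.
From mathcomp Require Import finmap boolp classical_sets reals complex monalg.

Set Implicit Arguments.
Unset Strict Implicit.
Unset Printing Implicit Defensive.

Import GRing.Theory.
Local Open Scope quotient_scope.
Local Open Scope ring_scope.

(* Multi-indices (i, j), ranging over Z_+ x Z_+. *)
Notation idx := (nat * nat)%type.

Definition addi (I J : idx) : idx := ((I.1 + J.1)%N, (I.2 + J.2)%N).

(* Quotient of an algebra by the two-sided ideal generated by relations
   l = r.  MathComp's quotient by an ideal covers commutative rings only, and
   its algebras are nonzero, whence the condition rel_proper. *)

Section AlgebraQuotient.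
Variables (K : fieldType) (A : algType K).

Inductive ideal_of (r : A -> A -> Prop) : A -> Prop :=
| Ideal0 : ideal_of r 0
| IdealD x y : ideal_of r x -> ideal_of r y -> ideal_of r (x + y)
| IdealR a x y b : r x y -> ideal_of r (a * (x - y) * b).

Record relations := Relations {
  rel_holds :> A -> A -> Prop;
  rel_proper : ~ ideal_of rel_holds 1 }.

Variable r : relations.

Lemma ideal_mull a x : ideal_of r x -> ideal_of r (a * x).
Proof.
elim=> [|u v _ IHu _ IHv|b u v c ruv].
- by rewrite mulr0; apply: Ideal0.
- by rewrite mulrDr; apply: IdealD.
- by rewrite !mulrA; apply: IdealR.
Qed.

Lemma ideal_mulr a x : ideal_of r x -> ideal_of r (x * a).
Proof.
elim=> [|u v _ IHu _ IHv|b u v c ruv].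
- by rewrite mul0r; apply: Ideal0.
- by rewrite mulrDl; apply: IdealD.
- by rewrite -mulrA; apply: IdealR.
Qed.

Definition ideal_pred : {pred A} := fun x => `[< ideal_of r x >].

Lemma ideal_zmod_closed : zmod_closed ideal_pred.
Proof.
split=> [|x y]; rewrite /in_mem /=; first exact/asboolP/Ideal0.
move=> /asboolP Ix /asboolP Iy; apply/asboolP; apply: IdealD => //.
by rewrite -mulN1r; apply: ideal_mull.
Qed.

HB.instance Definition _ := GRing.isZmodClosed.Build A ideal_pred
  ideal_zmod_closed.

Definition algquot : Type := Quotient.quot ideal_pred.
HB.instance Definition _ := GRing.Zmodule.on algquot.

Definition algpi (x : A) : algquot := \pi_(Quotient.quot ideal_pred) x.
Definition algrep (x : algquot) : A := repr (x : Quotient.quot ideal_pred).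

Lemma algrepK : cancel algrep algpi.
Proof. exact: reprK. Qed.

Lemma algpi_eq x y : (algpi x = algpi y) <-> ideal_of r (x - y).
Proof.
split=> [/eqP|h].
- by rewrite /algpi -Quotient.idealrBE => /asboolP.
- by apply/eqP; rewrite /algpi -Quotient.idealrBE; apply/asboolP.
Qed.

Lemma algpi_rel x y : r x y -> algpi x = algpi y.
Proof.
by move=> rxy; apply/algpi_eq; rewrite -[_ - _]mulr1 -[_ - _]mul1r;
  apply: IdealR.
Qed.

Lemma algpiD x y : algpi (x + y) = algpi x + algpi y.
Proof. by rewrite /algpi piE. Qed.

Lemma algpi0 : algpi 0 = 0.
Proof. by rewrite /algpi piE. Qed.

Lemma algpi_rep x : ideal_of r (algrep (algpi x) - x).
Proof. by apply/algpi_eq; rewrite algrepK. Qed.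

Definition aq_one : algquot := algpi 1.
Definition aq_mul (x y : algquot) : algquot := algpi (algrep x * algrep y).
Definition aq_scale (k : K) (x : algquot) : algquot := algpi (k *: algrep x).

Lemma aq_mulE x y : aq_mul (algpi x) (algpi y) = algpi (x * y).
Proof.
apply/algpi_eq; set x' := algrep _; set y' := algrep _.
have -> : x' * y' - x * y = (x' - x) * y' + x * (y' - y).
  by rewrite mulrBl mulrBr addrA subrK.
apply: IdealD; first exact/ideal_mulr/algpi_rep.
exact/ideal_mull/algpi_rep.
Qed.

Lemma aq_scaleE k x : aq_scale k (algpi x) = algpi (k *: x).
Proof.
apply/algpi_eq; rewrite -scalerBr -[_ - _]mul1r scalerAl.
exact/ideal_mull/algpi_rep.
Qed.

Let aqE := (aq_mulE, aq_scaleE).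

Lemma aq_mulA : associative aq_mul.
Proof.
by move=> x y z; rewrite -[x]algrepK -[y]algrepK -[z]algrepK !aqE mulrA.
Qed.

Lemma aq_mul1 : left_id aq_one aq_mul.
Proof. by move=> x; rewrite -[x]algrepK !aqE mul1r. Qed.

Lemma aq_mulr1 : right_id aq_one aq_mul.
Proof. by move=> x; rewrite -[x]algrepK !aqE mulr1. Qed.

Lemma aq_mulDl : left_distributive aq_mul +%R.
Proof.
move=> x y z; rewrite -[x]algrepK -[y]algrepK -[z]algrepK.
by rewrite -algpiD !aqE mulrDl algpiD.
Qed.

Lemma aq_mulDr : right_distributive aq_mul +%R.
Proof.
move=> x y z; rewrite -[x]algrepK -[y]algrepK -[z]algrepK.
by rewrite -algpiD !aqE mulrDr algpiD.
Qed.

Lemma aq_one_neq0 : aq_one != 0.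
Proof.
apply/eqP; rewrite /aq_one -algpi0 => /algpi_eq; rewrite subr0.
exact: rel_proper.
Qed.

HB.instance Definition _ := GRing.Zmodule_isNzRing.Build algquot
  aq_mulA aq_mul1 aq_mulr1 aq_mulDl aq_mulDr aq_one_neq0.

Lemma aq_scaleA a b x : aq_scale a (aq_scale b x) = aq_scale (a * b) x.
Proof. by rewrite -[x]algrepK !aqE scalerA. Qed.

Lemma aq_scale1 : left_id 1 aq_scale.
Proof. by move=> x; rewrite -[x]algrepK !aqE scale1r. Qed.

Lemma aq_scaleDr : right_distributive aq_scale +%R.
Proof.
move=> k x y; rewrite -[x]algrepK -[y]algrepK.
by rewrite -algpiD !aqE scalerDr algpiD.
Qed.

Lemma aq_scaleDl x : {morph aq_scale^~ x : a b / a + b}.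
Proof. by move=> a b; rewrite -[x]algrepK !aqE scalerDl algpiD. Qed.

HB.instance Definition _ := GRing.Zmodule_isLmodule.Build K algquot
  aq_scaleA aq_scale1 aq_scaleDr aq_scaleDl.

Lemma aq_scaleAl (k : K) (x y : algquot) : k *: (x * y) = (k *: x) * y.
Proof.
rewrite -[x]algrepK -[y]algrepK; change (aq_scale k (aq_mul (algpi (algrep x))
  (algpi (algrep y))) = aq_mul (aq_scale k (algpi (algrep x))) (algpi (algrep y))).
by rewrite !aqE scalerAl.
Qed.

HB.instance Definition _ := GRing.Lmodule_isLalgebra.Build K algquot aq_scaleAl.

Lemma aq_scaleAr (k : K) (x y : algquot) : k *: (x * y) = x * (k *: y).
Proof.
rewrite -[x]algrepK -[y]algrepK; change (aq_scale k (aq_mul (algpi (algrep x))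
  (algpi (algrep y))) = aq_mul (algpi (algrep x)) (aq_scale k (algpi (algrep y)))).
by rewrite !aqE scalerAr.
Qed.

HB.instance Definition _ := GRing.Lalgebra_isAlgebra.Build K algquot aq_scaleAr.

Lemma algpi_is_linear : linear algpi.
Proof.
by move=> k x y; rewrite algpiD; congr (_ + _); rewrite -aq_scaleE.
Qed.

HB.instance Definition _ := GRing.isLinear.Build K A algquot *:%R algpi
  algpi_is_linear.

Lemma algpi_is_monoid_morphism : monoid_morphism algpi.
Proof. by split=> // x y; rewrite -aq_mulE. Qed.

HB.instance Definition _ := GRing.isMonoidMorphism.Build A algquot algpi
  algpi_is_monoid_morphism.

End AlgebraQuotient.

Lemma malg_scaleAr (M : monomType) (R : comNzRingType) (k : R)
  (x y : {malg R[M]}) : k *: (x * y) = x * (k *: y).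
Proof.
rewrite -!mul_malgC !mulrA; congr (_ * _).
rewrite !malgM_def fgmulUg fgmulgU; apply: eq_bigr => m _.
by rewrite mulrC mul1m mulm1.
Qed.

Section MonoidAlgebra.
Variables (M : monomType) (K : fieldType).
Implicit Types (x : {malg K[M]}) (m n : M).

Lemma malgUM m n : (<< m >> : {malg K[M]}) * << n >> = << mmul m n >>.
Proof. by rewrite malgM_def fgmulUU mulr1. Qed.

Lemma malg_expand x : x = \sum_(m <- msupp x) x@_m *: << m >>.
Proof.
rewrite [LHS]monalgE; apply: eq_bigr => m _.
by apply/malgP => n; rewrite mcoeffZ !mcoeffU mulrnAr mulr1.
Qed.

Definition malg_lin (h : M -> K) x : K := mmap idfun h x.

Lemma malg_linU h m : malg_lin h << m >> = h m.
Proof. by rewrite /malg_lin mmapU mul1r. Qed.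

Lemma malg_linP h k x y :
  malg_lin h (k *: x + y) = k * malg_lin h x + malg_lin h y.
Proof.
have Z : malg_lin h (k *: x) = k * malg_lin h x.
  rewrite /malg_lin (mmapEw (msuppZ_le _ _)) /mmap big_distrr /=.
  by apply: eq_bigr => m _; rewrite mcoeffZ mulrA.
by rewrite -Z; apply: raddfD.
Qed.

End MonoidAlgebra.

Definition freealg (K : fieldType) (G : choiceType) : Type :=
  {malg K[{fmonom G}]}.

HB.instance Definition _ (K : fieldType) (G : choiceType) :=
  GRing.Lalgebra.on (freealg K G).
HB.instance Definition _ (K : fieldType) (G : choiceType) :=
  GRing.Lalgebra_isAlgebra.Build K (freealg K G)
  (@malg_scaleAr {fmonom G} K).

(* Locked for efficiency. *)
HB.lock Definition freemon (K : fieldType) (G : choiceType)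
  (m : {fmonom G}) : freealg K G := << m >>.

Section FreeAlgebra.
Variables (K : fieldType) (G : choiceType).
Local Notation freealg := (freealg K G).
Local Notation freemon := (@freemon K G).
Definition freegen (g : G) : freealg := freemon (fmu g).

Lemma freemonM m n : freemon m * freemon n = freemon (mmul m n).
Proof. by rewrite unlock; apply: malgUM. Qed.

Lemma freemon1 : freemon mone = 1.
Proof. by rewrite unlock. Qed.

Lemma freealg_expand x : x = \sum_(m <- msupp x) x@_m *: freemon m.
Proof.
by rewrite [LHS](malg_expand x); apply: eq_bigr => m _; rewrite unlock.
Qed.

Lemma freealg_functional (h : {fmonom G} -> K) :
  exists L : freealg -> K, (forall k x y, L (k *: x + y) = k * L x + L y) /\
    forall m, L (freemon m) = h m.
Proof.
rewrite unlock; exists (malg_lin h).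
by split; [apply: malg_linP|apply: malg_linU].
Qed.

Section Eval.
Variables (B : algType K) (f : G -> B).

Definition fword (m : {fmonom G}) : B := \prod_(g <- (m : seq G)) f g.

Lemma fword_mmorphism : mmorphism fword.
Proof.
by split=> [m n|]; rewrite /fword ?fmM ?big_cat // fm1 big_nil.
Qed.

HB.instance Definition _ := isMultiplicative.Build _ B fword fword_mmorphism.

(* The algebra morphism extending f. *)
Definition feval (x : freealg) : B := mmap (in_alg B) fword x.

Lemma feval_is_linear : linear feval.
Proof.
by move=> k x y; rewrite /feval raddfD /= mmapZ /= mulr_algl.
Qed.

HB.instance Definition _ := GRing.isLinear.Build K freealg B *:%R feval
  feval_is_linear.

Lemma feval_is_monoid_morphism : monoid_morphism feval.
Proof.
have comm (g : freealg) (m m' : {fmonom G}) :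
    GRing.comm (in_alg B (g@_m)%M) (fword m').
  by rewrite /GRing.comm /= mulr_algl mulr_algr.
by have [hM h1] := commr_mmap_is_multiplicative comm; split.
Qed.

HB.instance Definition _ := GRing.isMonoidMorphism.Build freealg B feval
  feval_is_monoid_morphism.

Lemma fevalE g : feval (freegen g) = f g.
Proof.
by rewrite /feval /freegen unlock mmapU /= scale1r mul1r /fword fmU big_seq1. Qed.

Lemma feval_proper (r : freealg -> freealg -> Prop) :
  (forall x y, r x y -> feval x = feval y) -> ~ ideal_of r 1.
Proof.
move=> hr; have H x : ideal_of r x -> feval x = 0.
  elim=> [|u v _ hu _ hv|a u v b ruv]; first exact: raddf0.
    by rewrite raddfD /= hu hv addr0.
  by rewrite !rmorphM /= raddfB /= (hr _ _ ruv) subrr mulr0 mul0r.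
by move=> /H; rewrite rmorph1 => /eqP; rewrite oner_eq0.
Qed.

End Eval.

End FreeAlgebra.

Definition presalg (K : fieldType) (G : choiceType)
  (r : relations (freealg K G)) : Type := algquot r.

HB.instance Definition _ (K : fieldType) (G : choiceType)
  (r : relations (freealg K G)) := GRing.Algebra.on (presalg r).

HB.lock Definition presgen (K : fieldType) (G : choiceType)
  (r : relations (freealg K G)) (g : G) : presalg r := algpi r (freegen K g).

Section Span.
Variables (K : fieldType) (V : lmodType K).

Inductive lspan (S : V -> Prop) : V -> Prop :=
| Lspan0 : lspan S 0
| LspanD k x y : S x -> lspan S y -> lspan S (k *: x + y).

Lemma lspan_gen (S : V -> Prop) x : S x -> lspan S x.
Proof.
by move=> Sx; rewrite -[x]addr0 -[x]scale1r; apply: LspanD => //; apply: Lspan0.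
Qed.

Lemma lspan_lin (S : V -> Prop) k x y :
  lspan S x -> lspan S y -> lspan S (k *: x + y).
Proof.
move=> Sx Sy; elim: Sx => [|c u v Su _ IH]; first by rewrite scaler0 add0r.
by rewrite scalerDr -addrA scalerA; apply: LspanD.
Qed.

End Span.

Lemma lspan_mul (K : fieldType) (A : algType K) (S1 S2 S3 : A -> Prop) x y :
  (forall u v, S1 u -> S2 v -> S3 (u * v)) ->
  lspan S1 x -> lspan S2 y -> lspan S3 (x * y).
Proof.
move=> h; elim=> [|k u v Su _ IH] Sy; first by rewrite mul0r; apply: Lspan0.
rewrite mulrDl -scalerAl; apply: lspan_lin; last exact: IH.
elim: Sy => [|c z w Sz _ IHw]; first by rewrite mulr0; apply: Lspan0.
by rewrite mulrDr -scalerAr; apply: LspanD => //; apply: h.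
Qed.

Section Functional.
Variables (K : fieldType) (V : lmodType K) (v : V).
Hypothesis v0 : v != 0.

Lemma functional_exists :
  exists f : V -> K, (forall k x y, f (k *: x + y) = k * f x + f y) /\ f v = 1.
Proof.
pose ok (U : V -> Prop) :=
  [/\ U 0, (forall k x y, U x -> U y -> U (k *: x + y)) & ~ U v].
pose T := {U : V -> Prop | ok U}.
pose R (U W : T) := `[< forall x, sval U x -> sval W x >].
have ok0 : ok (fun x => x = 0).
  split=> [//|k x y -> ->|/eqP]; first by rewrite scaler0 addr0.
  by rewrite (negbTE v0).
have RR U : R U U by apply/asboolP.
have Rtrans U W Z : R U W -> R W Z -> R U Z.
  by move=> /asboolP h1 /asboolP h2; apply/asboolP => x /h1 /h2.
have Ranti (U W : T) : R U W -> R W U -> U = W.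
  case: U W => [U hU] [W hW] /asboolP /= h1 /asboolP /= h2.
  have eUW : U = W.
    by apply/funext => x; apply/propext; split; [exact: h1|exact: h2].
  by case: _ / eUW in hW h1 h2 *; congr exist; apply: Prop_irrelevance.
have Rchain (C : set T) : total_on C (fun x y => R x y) ->
    exists t : T, forall s : T, C s -> R s t.
  move=> totC; have [[c0 Cc0]|noC] := pselect (exists c, C c); last first.
    by exists (exist _ _ ok0) => s Cs; case: noC; exists s.
  have okU : ok (fun x => exists2 c : T, C c & sval c x).
    split; first by exists c0 => //; case: (svalP c0).
    - move=> k x y [c Cc cx] [d Cd dy].
      have [/asboolP h|/asboolP h] := totC _ _ Cc Cd.
        by exists d => //; case: (svalP d) => _ hd _; apply: hd => //; apply: h.
      by exists c => //; case: (svalP c) => _ hc _; apply: hc => //; apply: h.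
    - by case=> c Cc cv; case: (svalP c).
  exists (exist _ _ okU) => s Cs; apply/asboolP => x sx.
  by exists s.
have [[U okU] maxU] := Zorn RR Rtrans Ranti Rchain.
have [U0 Ulin Uv] := okU.
have ex w : exists c, U (w - c *: v).
  have [Uw|nUw] := pselect (U w); first by exists 0; rewrite scale0r subr0.
  pose W x := exists c, U (x - c *: w).
  have UW x : U x -> W x by exists 0; rewrite scale0r subr0.
  have Wlin k x y : W x -> W y -> W (k *: x + y).
    move=> [c Uc] [d Ud]; exists (k * c + d).
    rewrite scalerDl -scalerA opprD addrACA -scalerBr; exact: Ulin.
  have [c Uc] : W v.
    apply: contrapT => nWv; have okW : ok W by split=> //; apply: UW.
    have /(congr1 sval) /= eUW := maxU (exist _ _ okW) (asboolT UW).
    by apply: nUw; rewrite -eUW; exists 1; rewrite scale1r subrr.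
  have c0 : c != 0 by apply/eqP => c0; apply: Uv; rewrite -[v]subr0 -(scale0r w) -c0.
  exists c^-1; have := Ulin (- c^-1) _ _ Uc U0.
  by rewrite addr0 scalerBr !scaleNr scalerA mulVf // scale1r opprK addrC.
have [f fP] := choice ex.
have uniq c d w : U (w - c *: v) -> U (w - d *: v) -> c = d.
  move=> Uc Ud; apply/eqP; rewrite -subr_eq0; apply/negPn/negP => cd.
  have Ucd : U ((c - d) *: v).
    have := Ulin (-1) _ _ Uc Ud; rewrite scaleN1r opprB addrA subrK.
    by rewrite scalerBl.
  apply: Uv; have := Ulin (c - d)^-1 _ _ Ucd U0.
  by rewrite addr0 scalerA mulVf // scale1r.
exists f; split=> [k x y|].
  apply: (uniq _ _ (k *: x + y)); first exact: fP.
  by rewrite scalerDl -scalerA opprD addrACA -scalerBr; apply: Ulin; apply: fP.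
by apply: (uniq _ _ v); [exact: fP|rewrite scale1r subrr].
Qed.

End Functional.

Section Tensor.
Variables (K : fieldType) (A B : algType K).

(* The tensor product has generators a (x) b, subject to bilinearity and to
   the rules for products and units; by the latter two, the generators span
   it as a vector space. *)
Inductive tensor_rel (F : algType K) (g : A -> B -> F) : F -> F -> Prop :=
| TensorDl a a' b : tensor_rel g (g (a + a') b) (g a b + g a' b)
| TensorDr a b b' : tensor_rel g (g a (b + b')) (g a b + g a b')
| TensorZl k a b : tensor_rel g (g (k *: a) b) (k *: g a b)
| TensorZr k a b : tensor_rel g (g a (k *: b)) (k *: g a b)
| TensorM a a' b b' : tensor_rel g (g a b * g a' b') (g (a * a') (b * b'))
| Tensor1 : tensor_rel g (g 1 1) 1.

Section Functionals.
Variables (F : algType K) (g : A -> B -> F).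
Variables (phi : A -> K) (psi : B -> K) (L : F -> K).
Hypothesis phiP : forall k x y, phi (k *: x + y) = k * phi x + phi y.
Hypothesis psiP : forall k x y, psi (k *: x + y) = k * psi x + psi y.
Hypothesis LP : forall k x y, L (k *: x + y) = k * L x + L y.

Lemma functional0 (V : lmodType K) (f : V -> K) :
  (forall k x y, f (k *: x + y) = k * f x + f y) -> f 0 = 0.
Proof.
move=> fP; have := fP 1 0 0; rewrite scaler0 addr0 mul1r => /esym/eqP.
by rewrite -subr_eq0 addrK => /eqP.
Qed.

Lemma functionalD (V : lmodType K) (f : V -> K) :
  (forall k x y, f (k *: x + y) = k * f x + f y) ->
  forall x y, f (x + y) = f x + f y.
Proof. by move=> fP x y; rewrite -[x in LHS]scale1r fP mul1r. Qed.

Lemma functionalZ (V : lmodType K) (f : V -> K) :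
  (forall k x y, f (k *: x + y) = k * f x + f y) ->
  forall k x, f (k *: x) = k * f x.
Proof. by move=> fP k x; rewrite -[_ *: _]addr0 fP (functional0 fP) addr0. Qed.

Lemma tensor_rel_functional (u v : F) (p q : A) (p' q' : B) x y :
  (forall a b, L (u * g a b * v) = phi (p * a * q) * psi (p' * b * q')) ->
  (forall a b a1 b1, L (u * (g a b * g a1 b1) * v) =
     phi (p * (a * a1) * q) * psi (p' * (b * b1) * q')) ->
  L (u * v) = phi (p * q) * psi (p' * q') ->
  tensor_rel g x y -> L (u * x * v) = L (u * y * v).
Proof.
have LD := functionalD LP; have LZ := functionalZ LP.
have pD := functionalD phiP; have pZ := functionalZ phiP.
have sD := functionalD psiP; have sZ := functionalZ psiP.
move=> h1 h2 h3; case=> [a a' b|a b b'|k a b|k a b|a a' b b'|].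
- by rewrite [in RHS]mulrDr [in RHS]mulrDl LD !h1 mulrDr mulrDl pD mulrDl.
- by rewrite [in RHS]mulrDr [in RHS]mulrDl LD !h1 [p' * (_ + _)]mulrDr
    [(_ + _) * q']mulrDl sD mulrDr.
- by rewrite -[in RHS]scalerAr -[in RHS]scalerAl LZ !h1 -scalerAr -scalerAl pZ mulrA.
- rewrite -[in RHS]scalerAr -[in RHS]scalerAl LZ !h1.
  by rewrite -[p' * _]scalerAr -[_ * q']scalerAl sZ mulrCA.
- by rewrite h2 h1.
- by rewrite h1 !mulr1 h3.
Qed.

Lemma kill_ideal (r : F -> F -> Prop) (S : Type) (w : S -> F) :
  (forall x, exists s : seq (K * S), x = \sum_(i <- s) i.1 *: w i.2) ->
  (forall m n x y, r x y -> L (w m * x * w n) = L (w m * y * w n)) ->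
  forall x, ideal_of r x -> L x = 0.
Proof.
have LD := functionalD LP; have LZ := functionalZ LP.
have L0 := functional0 LP.
move=> wP rP x; elim=> [//|x1 x2 _ h1 _ h2|u x1 x2 v rx].
  by rewrite LD h1 h2 addr0.
have [s ->] := wP u; have [t ->] := wP v.
rewrite !mulr_suml (big_morph L LD L0) big1 // => i _.
rewrite mulr_sumr (big_morph L LD L0) big1 // => j _.
rewrite -!scalerAl -scalerAr !LZ mulrBr mulrBl LD -scaleN1r LZ.
by rewrite (rP _ _ _ _ rx) mulN1r subrr !mulr0.
Qed.

End Functionals.

Let F : algType K := freealg K (A * B)%type.
Definition tgen (a : A) (b : B) : F := freegen K (a, b).

Lemma tensor_rel_proper : ~ ideal_of (tensor_rel tgen) 1.
Proof.
have [phi [phiP phi1]] := @functional_exists K A 1 (oner_neq0 _).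
have [psi [psiP psi1]] := @functional_exists K B 1 (oner_neq0 _).
pose P1 (m : {fmonom (A * B)%type}) := \prod_(i <- (m : seq (A * B))) i.1.
pose P2 (m : {fmonom (A * B)%type}) := \prod_(i <- (m : seq (A * B))) i.2.
pose h m := phi (P1 m) * psi (P2 m).
have [L [LP LU]] := freealg_functional h.
have wP (x : F) : exists s : seq (K * {fmonom (A * B)%type}),
    x = \sum_(i <- s) i.1 *: freemon K i.2.
  exists [seq (x@_m, m) | m <- msupp x]; rewrite big_map.
  exact: freealg_expand.
have := kill_ideal LP wP (r := tensor_rel tgen).
have LM (s : {fmonom (A * B)%type}) x : x = freemon K s -> L x = phi (P1 s) * psi (P2 s).
  by move=> ->; rewrite LU.
have P1M m n : P1 (mmul m n) = P1 m * P1 n by rewrite /P1 fmM big_cat.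
have P2M m n : P2 (mmul m n) = P2 m * P2 n by rewrite /P2 fmM big_cat.
have P1U a b : P1 (fmu (a, b)) = a by rewrite /P1 fmU big_seq1.
have P2U a b : P2 (fmu (a, b)) = b by rewrite /P2 fmU big_seq1.
have kill : forall m n x y, tensor_rel tgen x y ->
    L (freemon K m * x * freemon K n) = L (freemon K m * y * freemon K n).
  move=> m n x y.
  apply: (tensor_rel_functional phiP psiP LP (p := P1 m) (q := P1 n)
    (p' := P2 m) (q' := P2 n)).
  - move=> a b; rewrite (LM (mmul (mmul m (fmu (a, b))) n)).
      by rewrite !P1M !P2M P1U P2U.
    by rewrite /tgen /freegen !freemonM.
  - move=> a b a1 b1.
    rewrite (LM (mmul (mmul m (mmul (fmu (a, b)) (fmu (a1, b1)))) n)).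
      by rewrite !P1M !P2M !P1U !P2U.
    by rewrite /tgen /freegen !freemonM.
  - rewrite (LM (mmul m n)); first by rewrite P1M P2M.
    by rewrite freemonM.
move=> /(_ kill) {}kill /kill; rewrite (LM mone) ?freemon1 //.
by rewrite /P1 /P2 !fm1 !big_nil phi1 psi1 mulr1 => /eqP; rewrite oner_eq0.
Qed.

Definition tensor : Type := presalg (Relations tensor_rel_proper).
HB.instance Definition _ := GRing.Algebra.on tensor.

Definition pure (a : A) (b : B) : tensor := presgen _ (a, b).

Lemma pure_rel x y :
  tensor_rel tgen x y ->
  algpi (Relations tensor_rel_proper) x = algpi (Relations tensor_rel_proper) y.
Proof. by move=> h; apply: (@algpi_rel _ _ (Relations tensor_rel_proper)). Qed.

Lemma pureM a a' b b' : pure a b * pure a' b' = pure (a * a') (b * b').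
Proof. by rewrite /pure unlock -rmorphM; apply/pure_rel/TensorM. Qed.

Lemma pure1 : pure 1 1 = 1.
Proof.
rewrite /pure unlock -[RHS](rmorph1 (algpi (Relations tensor_rel_proper))).
exact/pure_rel/Tensor1.
Qed.

End Tensor.

Notation "a \ox b" := (pure a b) (at level 40, left associativity).

(* Completion. A grading supplies subspaces T_N, N in Z_+^2, of an algebra T
   with 1 in T_0 and T_M T_N contained in T_(M+N). The completion consists of
   the formal sums sum_N z_N with z_N in T_N, i.e. it is the product of the
   T_N, with the Cauchy product. *)

Record grading (K : fieldType) (T : algType K) := Grading {
  piece :> idx -> T -> Prop;
  piece0 : forall N, piece N 0;
  piece_lin : forall N k x y, piece N x -> piece N y -> piece N (k *: x + y);
  piece1 : piece (0, 0)%N 1;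
  pieceM : forall M N x y, piece M x -> piece N y -> piece (addi M N) (x * y) }.

Record completion (K : fieldType) (T : algType K) (D : grading T) := FormalSum {
  component :> idx -> T;
  component_in : forall N, D N (component N) }.

Section Completion.
Variables (K : fieldType) (T : algType K) (D : grading T).
Local Notation C := (completion D).
Implicit Types (x y z : C).

HB.instance Definition _ := gen_eqMixin C.
HB.instance Definition _ := gen_choiceMixin C.

Lemma completionP x y : component x =1 component y -> x = y.
Proof.
case: x y => [f fD] [g gD] /= /funext e; case: _ / e gD => gD.
by congr FormalSum; apply: Prop_irrelevance.
Qed.

Lemma pieceD N u v : D N u -> D N v -> D N (u + v).
Proof. by move=> Du Dv; rewrite -[u]scale1r; apply: piece_lin. Qed.

Lemma pieceZ N k u : D N u -> D N (k *: u).
Proof.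
by move=> Du; rewrite -[_ *: _]addr0; apply: piece_lin => //; apply: piece0.
Qed.

Definition fs_zero : C := FormalSum (fun N => piece0 D N).
Definition fs_add x y : C :=
  FormalSum (fun N => pieceD (component_in x N) (component_in y N)).
Definition fs_scale k x : C :=
  FormalSum (fun N => pieceZ k (component_in x N)).
Definition fs_opp x : C := fs_scale (-1) x.

Lemma fs_oneP N : D N (if N == (0, 0)%N then 1 else 0).
Proof. by case: eqP => [->|_]; [exact: piece1|exact: piece0]. Qed.
Definition fs_one : C := FormalSum fs_oneP.

Definition cauchy (f g : idx -> T) (N : idx) : T :=
  \sum_(a < N.1.+1) \sum_(b < N.2.+1) f (a : nat, b : nat) * g (N.1 - a, N.2 - b)%N.

Lemma cauchyP x y N : D N (cauchy x y N).
Proof.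
rewrite /cauchy; apply: (big_ind (D N)) => [||a _]; [exact: piece0|exact: pieceD|].
apply: (big_ind (D N)) => [||b _]; [exact: piece0|exact: pieceD|].
have e : addi (a : nat, b : nat) (N.1 - a, N.2 - b)%N = N.
  by case: N a b => i j a b; rewrite /addi /= !subnKC // -ltnS.
by rewrite -[N in D N]e; apply: pieceM; apply: component_in.
Qed.

Definition fs_mul x y : C := FormalSum (cauchyP x y).

Lemma fs_addA : associative fs_add.
Proof. by move=> x y z; apply: completionP => N /=; rewrite addrA. Qed.
Lemma fs_addC : commutative fs_add.
Proof. by move=> x y; apply: completionP => N /=; rewrite addrC. Qed.
Lemma fs_add0 : left_id fs_zero fs_add.
Proof. by move=> x; apply: completionP => N /=; rewrite add0r. Qed.
Lemma fs_addN : left_inverse fs_zero fs_opp fs_add.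
Proof. by move=> x; apply: completionP => N /=; rewrite scaleN1r addNr. Qed.

HB.instance Definition _ := GRing.isZmodule.Build C
  fs_addA fs_addC fs_add0 fs_addN.

(* Truncations of formal sums as polynomials in two variables. *)
Let trunc n (f : idx -> T) : {poly {poly T}} :=
  \poly_(i < n) \poly_(j < n) f (i, j).

Let trunc_coef n f i j : (i < n)%N -> (j < n)%N -> (trunc n f)`_i`_j = f (i, j).
Proof. by move=> hi hj; rewrite coef_poly hi coef_poly hj. Qed.

Let coefM2 (p r : {poly {poly T}}) i j : (p * r)`_i`_j =
  \sum_(a < i.+1) \sum_(b < j.+1) p`_a`_b * r`_(i - a)`_(j - b).
Proof. by rewrite coefM coef_sum; apply: eq_bigr => a _; rewrite coefM. Qed.

Let trunc_cauchy n f g i j : (i < n)%N -> (j < n)%N ->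
  (trunc n f * trunc n g)`_i`_j = cauchy f g (i, j).
Proof.
move=> hi hj; rewrite coefM2; apply: eq_bigr => a _; apply: eq_bigr => b _.
by rewrite !trunc_coef //; apply: leq_ltn_trans (leq_subr _ _) _ ||
  apply: leq_trans (ltn_ord _) _.
Qed.

Lemma fs_mulA : associative fs_mul.
Proof.
move=> x y z; apply: completionP => -[i j] /=.
set n := (maxn i j).+1.
have hi : (i < n)%N by rewrite ltnS leq_maxl.
have hj : (j < n)%N by rewrite ltnS leq_maxr.
have lt (m k : nat) (a : 'I_m.+1) : (m < k -> a < k)%N.
  by apply: leq_trans; apply: ltn_ord.
have ltB (m k : nat) (a : 'I_m.+1) : (m < k -> m - a < k)%N.
  by apply: leq_ltn_trans; apply: leq_subr.
transitivity ((trunc n x * (trunc n y * trunc n z))`_i`_j).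
  rewrite [RHS]coefM2; apply: eq_bigr => a _; apply: eq_bigr => b _.
  by rewrite trunc_coef ?trunc_cauchy ?lt ?ltB.
rewrite mulrA coefM2; apply: eq_bigr => a _; apply: eq_bigr => b _.
by rewrite trunc_coef ?trunc_cauchy ?lt ?ltB.
Qed.

Let cauchy_bigE f g N : cauchy f g N =
  \sum_(p : 'I_N.1.+1 * 'I_N.2.+1)
    f (p.1 : nat, p.2 : nat) * g (N.1 - p.1, N.2 - p.2)%N.
Proof. by rewrite /cauchy pair_big. Qed.

Lemma fs_mul1 : left_id fs_one fs_mul.
Proof.
move=> x; apply: completionP => -[i j] /=.
rewrite cauchy_bigE (bigD1 (ord0, ord0)) //= big1 => [|[a b] /= ab0].
  by rewrite ?eqxx mul1r addr0 !subn0.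
case: eqP => [[a0 b0]|]; last by rewrite mul0r.
case/eqP: ab0; congr (_, _); exact: val_inj.
Qed.

Lemma fs_mulr1 : right_id fs_one fs_mul.
Proof.
move=> x; apply: completionP => -[i j] /=.
rewrite cauchy_bigE (bigD1 (ord_max, ord_max)) //= big1 => [|[a b] /= ab0].
  by rewrite !subnn eqxx mulr1 addr0.
case: eqP => [[/eqP a0 /eqP b0]|]; last by rewrite mulr0.
rewrite !subn_eq0 in a0 b0; case/eqP: ab0; congr (_, _); apply: val_inj => /=.
  by apply/eqP; rewrite eqn_leq a0 -ltnS ltn_ord.
by apply/eqP; rewrite eqn_leq b0 -ltnS ltn_ord.
Qed.

Lemma fs_mulDl : left_distributive fs_mul +%R.
Proof.
move=> x y z; apply: completionP => N /=; rewrite !cauchy_bigE -big_split /=.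
by apply: eq_bigr => p _; rewrite mulrDl.
Qed.

Lemma fs_mulDr : right_distributive fs_mul +%R.
Proof.
move=> x y z; apply: completionP => N /=; rewrite !cauchy_bigE -big_split /=.
by apply: eq_bigr => p _; rewrite mulrDr.
Qed.

Lemma fs_one_neq0 : fs_one != 0.
Proof.
apply/eqP => /(congr1 (fun x : C => x (0, 0)%N)) /= /eqP.
by rewrite oner_eq0.
Qed.

HB.instance Definition _ := GRing.Zmodule_isNzRing.Build C
  fs_mulA fs_mul1 fs_mulr1 fs_mulDl fs_mulDr fs_one_neq0.

Lemma fs_scaleA a b x : fs_scale a (fs_scale b x) = fs_scale (a * b) x.
Proof. by apply: completionP => N /=; rewrite scalerA. Qed.
Lemma fs_scale1 : left_id 1 fs_scale.
Proof. by move=> x; apply: completionP => N /=; rewrite scale1r. Qed.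
Lemma fs_scaleDr : right_distributive fs_scale +%R.
Proof. by move=> k x y; apply: completionP => N /=; rewrite scalerDr. Qed.
Lemma fs_scaleDl x : {morph fs_scale^~ x : a b / a + b}.
Proof. by move=> a b; apply: completionP => N /=; rewrite scalerDl. Qed.

HB.instance Definition _ := GRing.Zmodule_isLmodule.Build K C
  fs_scaleA fs_scale1 fs_scaleDr fs_scaleDl.

Lemma fs_scaleAl (k : K) x y : k *: (x * y) = (k *: x) * y.
Proof.
apply: completionP => N /=; rewrite !cauchy_bigE scaler_sumr.
by apply: eq_bigr => p _; rewrite scalerAl.
Qed.
Lemma fs_scaleAr (k : K) x y : k *: (x * y) = x * (k *: y).
Proof.
apply: completionP => N /=; rewrite !cauchy_bigE scaler_sumr.
by apply: eq_bigr => p _; rewrite scalerAr.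
Qed.

HB.instance Definition _ := GRing.Lmodule_isLalgebra.Build K C fs_scaleAl.
HB.instance Definition _ := GRing.Lalgebra_isAlgebra.Build K C fs_scaleAr.

(* z is the infinite sum of the f N, the N-th term being homogeneous of
   degree N. *)
Definition sums_to (f : idx -> T) (z : C) : Prop := component z =1 f.

End Completion.

(* The grading of an algebra generated by a family g whose members are given
   weights in Z_+^2. *)
Section WeightGrading.
Variables (K : fieldType) (T : algType K) (G : Type) (g : G -> T) (wt : G -> idx).

Definition weight (s : seq G) : idx :=
  ((\sum_(c <- s) (wt c).1)%N, (\sum_(c <- s) (wt c).2)%N).

Definition word_of_weight (N : idx) (x : T) : Prop :=
  exists2 s : seq G, weight s = N & x = \prod_(c <- s) g c.

Lemma weight1 : lspan (word_of_weight (0, 0)%N) 1.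
Proof. by apply: lspan_gen; exists [::]; rewrite /weight !big_nil. Qed.

Lemma weightM M N x y : lspan (word_of_weight M) x ->
  lspan (word_of_weight N) y -> lspan (word_of_weight (addi M N)) (x * y).
Proof.
apply: lspan_mul => u v [s <- ->] [t <- ->]; exists (s ++ t).
  by rewrite /weight /addi /= !big_cat.
by rewrite big_cat.
Qed.

Definition weight_grading : grading T :=
  @Grading K T (fun N => lspan (word_of_weight N)) (fun N => Lspan0 _)
    (fun N k x y => @lspan_lin K T _ k x y) weight1 weightM.

End WeightGrading.

(* The gradings of A (x) B induced by a grading of one of the factors. *)
Section TensorGrading.
Variables (K : fieldType) (A B : algType K).

Definition pure_l (D : grading A) (N : idx) (x : tensor A B) : Prop :=
  exists a b, D N a /\ x = a \ox b.
Definition pure_r (D : grading B) (N : idx) (x : tensor A B) : Prop :=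
  exists a b, D N b /\ x = a \ox b.

Lemma pure_l1 D : lspan (pure_l D (0, 0)%N) 1.
Proof.
by apply: lspan_gen; exists 1, 1; rewrite pure1; split=> //; apply: piece1.
Qed.

Lemma pure_lM D M N x y : lspan (pure_l D M) x -> lspan (pure_l D N) y ->
  lspan (pure_l D (addi M N)) (x * y).
Proof.
apply: lspan_mul => _ _ [a [b [Da ->]]] [c [d [Dc ->]]].
by exists (a * c), (b * d); rewrite pureM; split=> //; apply: pieceM.
Qed.

Lemma pure_r1 D : lspan (pure_r D (0, 0)%N) 1.
Proof.
by apply: lspan_gen; exists 1, 1; rewrite pure1; split=> //; apply: piece1.
Qed.

Lemma pure_rM D M N x y : lspan (pure_r D M) x -> lspan (pure_r D N) y ->
  lspan (pure_r D (addi M N)) (x * y).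
Proof.
apply: lspan_mul => _ _ [a [b [Db ->]]] [c [d [Dd ->]]].
by exists (a * c), (b * d); rewrite pureM; split=> //; apply: pieceM.
Qed.

Definition grading_l (D : grading A) : grading (tensor A B) :=
  @Grading K (tensor A B) (fun N => lspan (pure_l D N)) (fun N => Lspan0 _)
    (fun N k x y => @lspan_lin K _ _ k x y) (pure_l1 D) (@pure_lM D).

Definition grading_r (D : grading B) : grading (tensor A B) :=
  @Grading K (tensor A B) (fun N => lspan (pure_r D N)) (fun N => Lspan0 _)
    (fun N k x y => @lspan_lin K _ _ k x y) (pure_r1 D) (@pure_rM D).

End TensorGrading.

Section Relations.
Variables (K : fieldType) (q : K) (F : algType K).

(* The sum over (a,b) + (c,d) = I of q^(bc) f_(a,b) g_(c,d). *)
Definition qconv (f g : idx -> F) (I : idx) : F :=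
  \sum_(a < I.1.+1) \sum_(b < I.2.+1)
    q ^+ (b * (I.1 - a)) *: (f (a : nat, b : nat) * g (I.1 - a, I.2 - b)%N).

Inductive qplane_rel (x y : F) : F -> F -> Prop :=
| QPlane : qplane_rel x y (y * x) (q *: (x * y)).

Inductive comeas_rel (t : idx -> idx -> F) : F -> F -> Prop :=
| ComeasM I J L : comeas_rel t
    (qconv (t^~ J) (t^~ L) I) (q ^+ (J.2 * L.1) *: t I (addi J L))
| Comeas1 : comeas_rel t (t (0, 0)%N (0, 0)%N) 1
| Comeas0 I : I != (0, 0)%N -> comeas_rel t (t I (0, 0)%N) 0.

Inductive st_rel (s t : idx -> F) : F -> F -> Prop :=
| StComm I : st_rel s t (q *: qconv s t I) (qconv t s I).

(* The sum over (a_1,b_1) + ... + (a_k,b_k) = I of the ordered products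
   f_(a_1,b_1) ... f_(a_k,b_k) q^(sum_(r = 2)^k (b_1 + ... + b_(r-1)) a_r);
   the positions 1, ..., k are numbered 0, ..., k-1 below. *)
Definition qpower (f : idx -> F) (k : nat) (I : idx) : F :=
  \sum_(a : {ffun 'I_k -> 'I_(I.1.+1)} | (\sum_r a r)%N == I.1)
  \sum_(b : {ffun 'I_k -> 'I_(I.2.+1)} | (\sum_r b r)%N == I.2)
    q ^+ (\sum_(r < k | 0 < r) (\sum_(p < k | p < r) b p) * a r)%N
      *: \prod_(r < k) f (a r : nat, b r : nat).

End Relations.

Section Morphisms.
Variables (K : fieldType) (q : K) (F B : algType K) (h : {lrmorphism F -> B}).

Lemma qconv_map (f g : idx -> F) I :
  h (qconv q f g I) = qconv q (fun A => h (f A)) (fun A => h (g A)) I.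
Proof.
rewrite linear_sum; apply: eq_bigr => a _.
rewrite linear_sum; apply: eq_bigr => b _.
by rewrite linearZ /= rmorphM.
Qed.

Lemma qplane_rel_map x y u v : h y * h x = q *: (h x * h y) ->
  qplane_rel q x y u v -> h u = h v.
Proof. by move=> e [] {u v}; rewrite linearZ /= !rmorphM. Qed.

Lemma comeas_rel_map (t : idx -> idx -> F) u v :
  (forall I J L, qconv q (fun A => h (t A J)) (fun A => h (t A L)) I =
     q ^+ (J.2 * L.1) *: h (t I (addi J L))) ->
  h (t (0, 0)%N (0, 0)%N) = 1 ->
  (forall I, I != (0, 0)%N -> h (t I (0, 0)%N) = 0) ->
  comeas_rel q t u v -> h u = h v.
Proof.
move=> hM h1 h0 [I J L||I I0]; last by rewrite (h0 _ I0) raddf0.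
  by rewrite qconv_map linearZ /= -hM.
by rewrite h1 rmorph1.
Qed.

Lemma st_rel_map (s t : idx -> F) u v :
  (forall I, q *: qconv q (fun A => h (s A)) (fun A => h (t A)) I =
     qconv q (fun A => h (t A)) (fun A => h (s A)) I) ->
  st_rel q s t u v -> h u = h v.
Proof. by move=> hst [I]; rewrite linearZ /= !qconv_map. Qed.

End Morphisms.

Section Comeasuring.
Variables (K : fieldType) (q : K).

Lemma qplane_proper : ~ ideal_of (qplane_rel q
  (freegen K true) (freegen K false)) 1.
Proof.
apply: (@feval_proper K bool K^o (fun=> 0)) => u v.
apply: qplane_rel_map.
by rewrite /= !fevalE mul0r scaler0.
Qed.

(* Generated by x = true and y = false. *)
Definition qplane : Type := presalg (Relations qplane_proper).
HB.instance Definition _ := GRing.Algebra.on qplane.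

Definition px : qplane := presgen _ true.
Definition py : qplane := presgen _ false.
Definition pe (I : idx) : qplane := px ^+ I.1 * py ^+ I.2.

Definition qplane_grading : grading qplane :=
  weight_grading (fun c : bool => presgen (Relations qplane_proper) c)
    (fun c => if c then (1, 0)%N else (0, 1)%N).

Lemma qconv_delta (J L I : idx) :
  qconv q (fun A => (A == J)%:R : K^o) (fun A => (A == L)%:R) I =
  q ^+ (J.2 * L.1) *: ((I == addi J L)%:R : K^o).
Proof.
rewrite /qconv pair_big /=; case: eqP => [->|neIJL].
  have h1 : (J.1 < (addi J L).1.+1)%N by rewrite ltnS leq_addr.
  have h2 : (J.2 < (addi J L).2.+1)%N by rewrite ltnS leq_addr.
  rewrite (bigD1 (Ordinal h1, Ordinal h2)) //= big1 => [|[a b] /= ne].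
    by rewrite addr0 !addKn -!surjective_pairing !eqxx mulr1.
  case: eqP => [eJ|_]; last by rewrite mul0r scaler0.
  case/eqP: ne; congr (_, _); apply: val_inj.
    exact: (congr1 fst eJ).
  exact: (congr1 snd eJ).
rewrite scaler0 big1 // => -[a b] _ /=.
case: eqP => [eJ|_]; last by rewrite mul0r scaler0.
case: eqP => [eL|_]; last by rewrite mulr0 scaler0.
case: neIJL; rewrite -eJ -eL /addi /= !subnKC -1?ltnS //.
exact: surjective_pairing.
Qed.

Lemma comeas_proper : ~ ideal_of (comeas_rel q
  (fun I J => freegen K (I, J))) 1.
Proof.
apply: (@feval_proper K _ K^o (fun c : idx * idx => (c.1 == c.2)%:R)).
move=> u v; apply: comeas_rel_map => [I J L||I /negbTE I0].
- rewrite /= fevalE -qconv_delta /qconv.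
  by apply: eq_bigr => a _; apply: eq_bigr => b _; rewrite !fevalE.
- by rewrite /= fevalE.
- by rewrite /= fevalE /= I0.
Qed.

Definition comeas : Type := presalg (Relations comeas_proper).
HB.instance Definition _ := GRing.Algebra.on comeas.

(* tC I J is the generator with upper index I and lower index J. *)
Definition tC (I J : idx) : comeas := presgen _ (I, J).

(* Every relation is homogeneous for the upper index of the generators. *)
Definition comeas_grading : grading comeas :=
  weight_grading (fun c : idx * idx => presgen (Relations comeas_proper) c) fst.

Lemma st_proper : ~ ideal_of (st_rel q
  (fun I => freegen K (inl I : idx + idx)%type)
  (fun I => freegen K (inr I : idx + idx)%type)) 1.
Proof.
apply: (@feval_proper K _ K^o (fun=> 0)) => u v; apply: st_rel_map => I.
rewrite /qconv !big1 ?scaler0 //.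
  by move=> a _; rewrite big1 // => b _; rewrite /= !fevalE mul0r scaler0.
by move=> a _; rewrite big1 // => b _; rewrite /= !fevalE mul0r scaler0.
Qed.

(* Generated by s_I = inl I and t_I = inr I. *)
Definition stalg : Type := presalg (Relations st_proper).
HB.instance Definition _ := GRing.Algebra.on stalg.

Definition sS (I : idx) : stalg := presgen _ (inl I).
Definition tS (I : idx) : stalg := presgen _ (inr I).

(* With M = comeas, the completions of C_q^2 (x) M and M (x) M in which the
   coaction and the coproduct take their values: the sums over I of
   e_I (x) t^I_J and over L of t^I_L (x) t^L_J are formal sums of terms that
   are homogeneous for the degree of e_I and the upper index of t^L_J. *)
Definition qplane_comeas : Type :=
  completion (@grading_l K qplane comeas qplane_grading).
HB.instance Definition _ := GRing.Algebra.on qplane_comeas.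

Definition comeas_comeas : Type :=
  completion (@grading_r K comeas comeas comeas_grading).
HB.instance Definition _ := GRing.Algebra.on comeas_comeas.

End Comeasuring.

(* Main.v *)
Require Import Defs.
From HB Require Import structures.
From mathcomp Require Import all_boot all_order all_algebra.
From mathcomp Require Import boolp functions.
From mathcomp Require Import reals complex monalg.

(* For an algebra F, the families (f_I) in F, read as series sum_I e_I f_I with
   the e_I commuting with F, form an algebra under the twisted convolution
   qconv.  The comeasuring relations say that the columns t_J of the matrix
   (t^I_J), viewed as such series, multiply like the basis e_J of C_q^2, so that
   t_(k,l) = S^k T^l for S = t_(1,0) and T = t_(0,1), and they reduce to
   T S = q S T.  This yields the presentation, and the formulas for the higher
   generators are the expansions of S^k and T^l.  The coaction, the coproduct
   and the counit come from the universal properties, and a morphism out of M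
   is determined by its values on the s_I and t_I. *)

Set Implicit Arguments.
Unset Strict Implicit.
Unset Printing Implicit Defensive.

Import GRing.Theory.
Local Open Scope ring_scope.

(** * Morphisms out of presented algebras *)

Section Presentations.
Variable K : fieldType.

Section QuotientLift.
Variables (A B : algType K) (r : relations A) (h : {lrmorphism A -> B}).
Hypothesis hr : forall u v, r u v -> h u = h v.

Lemma ideal_of_ker x : ideal_of r x -> h x = 0.
Proof.
elim=> [|u v _ hu _ hv|a u v b ruv]; first exact: raddf0.
  by rewrite raddfD /= hu hv addr0.
by rewrite !rmorphM raddfB /= (hr ruv) subrr mulr0 mul0r.
Qed.

(** The lift evaluates [h] on the chosen representative. By [ideal_of_ker] the value depends only on
    the class, so linearity and multiplicativity can be checked on images under [algpi]. *)
Lemma algquot_lift :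
  exists g : {lrmorphism algquot r -> B}, forall x, g (algpi r x) = h x.
Proof.
pose g (x : algquot r) : B := h (algrep x).
have gE x : g (algpi r x) = h x.
  by apply/eqP; rewrite -subr_eq0 -raddfB; apply/eqP/ideal_of_ker/algpi_rep.
have g_linear : linear g.
  move=> k x y; rewrite -[x]algrepK -[y]algrepK -linearP /= !gE.
  by rewrite linearP.
have g_mul : monoid_morphism g.
  split=> [|x y]; first by rewrite -(rmorph1 (algpi r)) gE rmorph1.
  by rewrite -[x]algrepK -[y]algrepK -rmorphM /= !gE rmorphM.
pose gL := GRing.isLinear.Build K (algquot r) B *:%R g g_linear.
pose gM := GRing.isMonoidMorphism.Build (algquot r) B g g_mul.
pose g' : {lrmorphism algquot r -> B} := HB.pack g gL gM.
by exists g'.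
Qed.

End QuotientLift.

Variable G : choiceType.

(** Induction on the list of letters. It reduces the equality of two morphisms to their equality on
    generators. *)
Lemma freemon_prod (m : {fmonom G}) :
  freemon K m = \prod_(g <- (m : seq G)) freegen K g.
Proof.
case: m => s; elim: s => [|g s IH].
  by rewrite big_nil -freemon1; congr freemon; apply: val_inj; rewrite [RHS]fm1.
rewrite /= big_cons -IH /freegen freemonM; congr freemon.
by apply: val_inj; rewrite [RHS]fmM fmU.
Qed.

Variables (r : relations (freealg K G)) (B : algType K).

Lemma presalg_lift (f : G -> B) :
  (forall u v, r u v -> feval f u = feval f v) ->
  exists h : {lrmorphism presalg r -> B}, forall g, h (presgen r g) = f g.
Proof.
move=> /algquot_lift[h hE]; exists h => g.
by rewrite unlock hE /= fevalE.
Qed.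

Lemma presalg_morph_eq (h h' : {lrmorphism presalg r -> B}) :
  (forall g, h (presgen r g) = h' (presgen r g)) -> h =1 h'.
Proof.
rewrite unlock => e x; rewrite -[x]algrepK [algrep x]freealg_expand.
rewrite !linear_sum; apply: eq_bigr => m _; rewrite !linearZ /=; congr (_ *: _).
by rewrite freemon_prod !rmorph_prod /=; apply: eq_bigr => g _; apply: e.
Qed.

End Presentations.

(** * The algebra of twisted series *)

Lemma sum3_reassoc (V : nmodType) (G : nat -> nat -> nat -> V) (i : nat) :
  \sum_(u < i.+1) \sum_(a < u.+1) G a (u - a)%N (i - u)%N =
  \sum_(a < i.+1) \sum_(c < (i - a).+1) G a c (i - a - c)%N.
Proof.
(* Both sides run over the triples with sum [i], the left one grouped by [u], the sum of the first
   two entries. Widening the inner range under the guard [a <= u] permits the exchange of sums; then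
   [u] is shifted by [a]. *)
transitivity (\sum_(u < i.+1) \sum_(a < i.+1 | (a <= u)%N)
    G a (u - a)%N (i - u)%N).
  apply: eq_bigr => u _; rewrite (big_ord_narrow_leq (leq_ord u)).
  by apply: eq_bigr.
rewrite (exchange_big_dep predT) //=; apply: eq_bigr => a _.
have ai := leq_ord a.
rewrite -(big_mkord (fun u => a <= u)%N (fun u => G a (u - a) (i - u)))%N.
rewrite (big_cat_nat (n := a)) //=; last exact: leqW.
rewrite big_nat_cond big_pred0 => [|u]; last by rewrite /= ltnNge andNb.
rewrite add0r -{1}[a : nat]add0n big_addn subSn // big_mkord.
apply: eq_big => [c|c _]; first by rewrite leq_addl.
by rewrite addnK addnC subnDA.
Qed.

Section TwistedSeries.
Variables (K : fieldType) (q : K) (F : algType K).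
Implicit Types f g h : idx -> F.

(** The twist is a 2-cocycle: for indices [(a, b)], [(c, d)], [(e, k)] both bracketings give the
    exponent [b * c + b * e + d * e] recorded in [G]. *)
Lemma qconvA f g h I : qconv q f (qconv q g h) I = qconv q (qconv q f g) h I.
Proof.
case: I => i j; rewrite /qconv /=; symmetry.
pose G a c e b d k := q ^+ (b * c + b * e + d * e)%N *:
  (f (a, b) * g (c, d) * h (e, k)).
transitivity (\sum_(u < i.+1) \sum_(a < u.+1) \sum_(v < j.+1) \sum_(b < v.+1)
    G a (u - a)%N (i - u)%N b (v - b)%N (j - v)%N).
  apply: eq_bigr => u _; rewrite exchange_big /=; apply: eq_bigr => v _.
  rewrite mulr_suml scaler_sumr; apply: eq_bigr => a _.
  rewrite mulr_suml scaler_sumr; apply: eq_bigr => b _.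
  rewrite -scalerAl scalerA -exprD /G; congr (q ^+ _ *: _).
  by rewrite -addnA -mulnDl subnKC -1?ltnS // addnC.
rewrite (sum3_reassoc (fun a c e => \sum_(v < j.+1) \sum_(b < v.+1)
    G a c e b (v - b)%N (j - v)%N)).
apply: eq_bigr => a _ /=.
under eq_bigr => c _ do rewrite (sum3_reassoc (G a c _)).
rewrite exchange_big /=; apply: eq_bigr => b _.
rewrite mulr_sumr scaler_sumr; apply: eq_bigr => c _.
rewrite mulr_sumr scaler_sumr; apply: eq_bigr => d _.
rewrite -scalerAr scalerA -exprD mulrA /G; congr (q ^+ _ *: _).
by rewrite -mulnDr subnKC -1?ltnS.
Qed.

Definition qmono (A : idx) (v : F) : idx -> F := fun I => if I == A then v else 0.

Lemma qconv_monol A v g I : qconv q (qmono A v) g I =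
  if (A.1 <= I.1)%N && (A.2 <= I.2)%N
  then q ^+ (A.2 * (I.1 - A.1)) *: (v * g (I.1 - A.1, I.2 - A.2)%N) else 0.
Proof.
rewrite /qconv pair_big /=; case: ifP => [/andP[h1 h2]|hA].
  have l1 : (A.1 < I.1.+1)%N by [].
  have l2 : (A.2 < I.2.+1)%N by [].
  rewrite (bigD1 (Ordinal l1, Ordinal l2)) //= big1 => [|[a b] /= ne].
    by rewrite addr0 /qmono -surjective_pairing eqxx.
  rewrite /qmono; case: eqP => [eA|_]; last by rewrite mul0r scaler0.
  by case/eqP: ne; congr (_, _); apply: val_inj; rewrite /= -eA.
rewrite big1 // => -[a b] _ /=.
rewrite /qmono; case: eqP => [eA|_]; last by rewrite mul0r scaler0.
by move: hA; rewrite -eA /= !leq_ord.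
Qed.

(** Reading [qmono A u] as [e_A u], this is the product rule of the basis of C_q^2 with coefficients
    that commute with it. *)
Lemma qconv_mono A B u v :
  qconv q (qmono A u) (qmono B v) = qmono (addi A B) (q ^+ (A.2 * B.1) *: (u * v)).
Proof.
apply/funext => I; rewrite qconv_monol /qmono.
case: I A B => [i j] [a b] [c d]; rewrite /addi /= !xpair_eqE.
case: (leqP a i) => [ai|ia] /=; last first.
  by rewrite [i == _]ltn_eqF // (leq_trans ia) ?leq_addr.
case: (leqP b j) => [bj|jb] /=; last first.
  by rewrite [j == _]ltn_eqF ?andbF // (leq_trans jb) ?leq_addr.
rewrite -(eqn_add2l a (i - a)%N) subnKC // -(eqn_add2l b (j - b)%N) subnKC //.
by case: andP => [[/eqP-> _]|_]; rewrite ?addKn // mulr0 scaler0.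
Qed.

Lemma qconv1l g : qconv q (qmono (0, 0)%N 1) g = g.
Proof.
by apply/funext => -[i j]; rewrite qconv_monol /= scale1r mul1r !subn0.
Qed.

Lemma qconv1r f : qconv q f (qmono (0, 0)%N 1) = f.
Proof.
apply/funext => -[i j]; rewrite /qconv pair_big /=.
(* The right factor is the unit only if nothing is left of [(i, j)], that is, if the left factor
   takes the whole index. *)
rewrite (bigD1 (ord_max, ord_max)) //= big1 => [|[a b] /= ne].
  by rewrite !subnn /qmono eqxx muln0 scale1r mulr1 addr0.
rewrite /qmono; case: eqP => [[/eqP a0 /eqP b0]|_]; last by rewrite mulr0 scaler0.
rewrite !subn_eq0 in a0 b0; case/eqP: ne; congr (_, _); apply: val_inj => /=.
  by apply/eqP; rewrite eqn_leq a0 -ltnS ltn_ord.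
by apply/eqP; rewrite eqn_leq b0 -ltnS ltn_ord.
Qed.

(* The argument q only selects the product. *)
Definition qseries (_ : K) : Type := idx -> F.
HB.instance Definition _ := GRing.Lmodule.copy (qseries q) (idx -> F).

Definition qone : qseries q := qmono (0, 0)%N 1.
Definition qmul (x y : qseries q) : qseries q := qconv q x y.

Lemma qmulA : associative qmul.
Proof. by move=> x y z; apply/funext => I; apply: qconvA. Qed.

Lemma qmul1 : left_id qone qmul.
Proof. exact: qconv1l. Qed.

Lemma qmulr1 : right_id qone qmul.
Proof. exact: qconv1r. Qed.

Lemma qmulDl : left_distributive qmul +%R.
Proof.
move=> x y z; apply/funext => I; rewrite /qmul /qconv -[RHS]big_split.
apply: eq_bigr => a _; rewrite -big_split; apply: eq_bigr => b _.
by rewrite /= mulrDl scalerDr.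
Qed.

Lemma qmulDr : right_distributive qmul +%R.
Proof.
move=> x y z; apply/funext => I; rewrite /qmul /qconv -[RHS]big_split.
apply: eq_bigr => a _; rewrite -big_split; apply: eq_bigr => b _.
by rewrite /= mulrDr scalerDr.
Qed.

Lemma qone_neq0 : qone != 0.
Proof.
apply/eqP => /(congr1 (fun x : qseries q => x (0, 0)%N)) /eqP.
by rewrite /qone /qmono eqxx oner_eq0.
Qed.

HB.instance Definition _ := GRing.Zmodule_isNzRing.Build (qseries q)
  qmulA qmul1 qmulr1 qmulDl qmulDr qone_neq0.

Lemma qmul_scaleAl (k : K) (x y : qseries q) : k *: (x * y) = (k *: x) * y.
Proof.
apply/funext => I; rewrite [LHS]scaler_sumr; apply: eq_bigr => a _.
rewrite scaler_sumr; apply: eq_bigr => b _.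
by rewrite scalerA mulrC -scalerA; congr (_ *: _); apply: scalerAl.
Qed.

Lemma qmul_scaleAr (k : K) (x y : qseries q) : k *: (x * y) = x * (k *: y).
Proof.
apply/funext => I; rewrite [LHS]scaler_sumr; apply: eq_bigr => a _.
rewrite scaler_sumr; apply: eq_bigr => b _.
by rewrite scalerA mulrC -scalerA; congr (_ *: _); apply: scalerAr.
Qed.

HB.instance Definition _ := GRing.Lmodule_isLalgebra.Build K (qseries q)
  qmul_scaleAl.
HB.instance Definition _ := GRing.Lalgebra_isAlgebra.Build K (qseries q)
  qmul_scaleAr.

End TwistedSeries.

(** * Pairs with [y * x = q *: (x * y)] and their ordered monomials *)

Section QCommuting.
Variables (K : fieldType) (q : K) (A : algType K).

(** One [y] is first moved past a power of [x], at the cost of one [q] per [x]; induction on [m]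
    does the rest. *)
Lemma qcomm_exp (x y : A) m n : y * x = q *: (x * y) ->
  y ^+ m * x ^+ n = q ^+ (m * n) *: (x ^+ n * y ^+ m).
Proof.
move=> yx; have y_xn k : y * x ^+ k = q ^+ k *: (x ^+ k * y).
  elim: k => [|k IH]; first by rewrite !expr0 mul1r mulr1 scale1r.
  rewrite [in LHS]exprS mulrA yx -scalerAl -[x * y * _]mulrA IH -scalerAr scalerA.
  by rewrite mulrA -!exprS.
elim: m => [|m IH]; first by rewrite !expr0 mul1r mulr1 scale1r.
rewrite exprS -[LHS]mulrA IH -scalerAr [y * (x ^+ n * _)]mulrA y_xn -scalerAl scalerA -exprD.
by rewrite mulSn addnC -mulrA.
Qed.

(** Only [y ^+ J.2] has to pass [x ^+ L.1]. Together with [family_monomial] and [family_qcomm] this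
    makes families that multiply like the basis of C_q^2 the same thing as q-commuting pairs. *)
Lemma qcomm_monomialM (x y : A) (J L : idx) : y * x = q *: (x * y) ->
  (x ^+ J.1 * y ^+ J.2) * (x ^+ L.1 * y ^+ L.2) =
  q ^+ (J.2 * L.1) *: (x ^+ (addi J L).1 * y ^+ (addi J L).2).
Proof.
move=> yx; rewrite mulrA -[_ * _ * x ^+ _]mulrA qcomm_exp //.
by rewrite -scalerAr -scalerAl !mulrA -exprD -mulrA -exprD.
Qed.

Section Family.
Variable e : idx -> A.
Hypothesis eM : forall J L, e J * e L = q ^+ (J.2 * L.1) *: e (addi J L).
Hypothesis e1 : e (0, 0)%N = 1.

Lemma family_monomial J : e J = e (1, 0)%N ^+ J.1 * e (0, 1)%N ^+ J.2.
Proof.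
have ex k : e (1, 0)%N ^+ k = e (k, 0)%N.
  elim: k => [|k IH]; first by rewrite e1.
  by rewrite exprS IH eM scale1r /addi.
have ey k : e (0, 1)%N ^+ k = e (0, k)%N.
  by elim: k => [|k IH]; rewrite ?e1 // exprS IH eM muln0 scale1r /addi.
by rewrite ex ey eM mul0n scale1r /addi /= addn0 -surjective_pairing.
Qed.

Lemma family_qcomm : e (0, 1)%N * e (1, 0)%N = q *: (e (1, 0)%N * e (0, 1)%N).
Proof. by rewrite !eM scale1r. Qed.

End Family.
End QCommuting.

(** * Coefficientwise images of series *)

Section SeriesMap.
Variables (K : fieldType) (q : K) (F B : algType K) (h : {lrmorphism F -> B}).

Lemma qseries_map_exp (x : qseries F q) n :
  (fun I => h ((x ^+ n) I)) = ((fun I => h (x I)) : qseries B q) ^+ n.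
Proof.
elim: n => [|n IH].
  apply/funext => I; rewrite !expr0 /GRing.one /= /qone /qmono.
  by case: eqP; rewrite ?rmorph1 ?raddf0.
by rewrite !exprS -IH; apply/funext => I; apply: qconv_map.
Qed.

Lemma qseries_map_monomial (x y : qseries F q) m n I :
  h ((x ^+ m * y ^+ n) I) =
  (((fun A => h (x A)) : qseries B q) ^+ m * ((fun A => h (y A)) : qseries B q) ^+ n) I.
Proof. by rewrite -!qseries_map_exp; apply: qconv_map. Qed.

End SeriesMap.

(** * Coefficients of the powers of a series *)

Section PowerFormula.
Variables (K : fieldType) (q : K) (F : algType K).

Let mono (A : idx) (v : F) : qseries F q := qmono A v.

(** Splitting off the last factor contributes the sum of all earlier [b] times the last [a], which
    is the last term of the exponent. *)
Lemma qseries_prod_mono k (a b : 'I_k -> nat) (v : 'I_k -> F) :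
  \prod_r mono (a r, b r) (v r) =
  mono (\sum_r a r, \sum_r b r)%N
    (q ^+ (\sum_(r < k | 0 < r) (\sum_(p < k | p < r) b p) * a r)%N
      *: \prod_r v r).
Proof.
elim: k a b v => [|k IH] a b v; first by rewrite !big_ord0 scale1r.
rewrite big_ord_recr IH /mono [LHS]qconv_mono; congr (qmono _ _).
  by rewrite /addi /= !big_ord_recr.
rewrite -scalerAl scalerA -exprD [in RHS]big_ord_recr /=; congr (q ^+ _ *: _).
rewrite [RHS]big_mkcond big_ord_recr -big_mkcond /=.
rewrite addnC; congr (_ + _)%N.
  apply: eq_bigr => r _; congr (_ * _)%N.
  rewrite [RHS]big_mkcond big_ord_recr -big_mkcond /=.
  by rewrite ltnNge ltnW // addn0.
(* The guard [0 < r] excludes the new position only when [k = 0]; the contribution is then zero, the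
   sum of earlier [b] being empty. *)
case: ifP => [_|/negbT]; last by rewrite -eqn0Ngt => /eqP k0; subst k; rewrite big_ord0.
congr (_ * _)%N; rewrite [RHS]big_mkcond big_ord_recr -big_mkcond /= ltnn addn0.
by apply: eq_bigl => p; rewrite ltn_ord.
Qed.

(** A coefficient of a product involves only coefficients at componentwise smaller or equal indices.
    This lets [x] be truncated to a finite sum of monomials. *)
Lemma qseries_exp_local (x y : qseries F q) I k :
  (forall A, (A.1 <= I.1)%N -> (A.2 <= I.2)%N -> x A = y A) ->
  (x ^+ k) I = (y ^+ k) I.
Proof.
move=> xy; suff H A : (A.1 <= I.1)%N -> (A.2 <= I.2)%N -> (x ^+ k) A = (y ^+ k) A.
  exact: H.
elim: k A => [|k IH] A A1 A2 //; rewrite !exprS.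
apply: eq_bigr => a _; apply: eq_bigr => b _.
rewrite xy /= ?IH //=; try exact: leq_trans (leq_subr _ _) _.
- exact: leq_trans (leq_ord _) _.
- exact: leq_trans (leq_ord _) _.
Qed.

Lemma qseries_sumE (T : Type) (r : seq T) (f : T -> qseries F q) I :
  (\sum_(i <- r) f i) I = \sum_(i <- r) f i I.
Proof. by elim/big_ind2: _ => // u y v z <- <-. Qed.

Lemma qseries_expE (x : qseries F q) k I : (x ^+ k) I = qpower q x k I.
Proof.
pose T := ('I_I.1.+1 * 'I_I.2.+1)%type.
have eqI u v : (I == (u, v)) = (u == I.1) && (v == I.2).
  by case: (I) => i j; rewrite xpair_eqE eq_sym [j == _]eq_sym.
(* The truncation of [x] to indices at most [I] is a finite sum, so its power expands by
   distributivity into products of monomials, of which those of total index [I] contribute. *)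
rewrite (@qseries_exp_local x
  (\sum_(p : T) mono (p.1 : nat, p.2 : nat) (x (p.1 : nat, p.2 : nat)))).
  rewrite -[k in LHS]card_ord -prodr_const bigA_distr_bigA /= qseries_sumE.
  under eq_bigr => g _ do rewrite qseries_prod_mono.
  rewrite /mono /qmono -big_mkcond /qpower pair_big /=.
  (* Distributivity yields one function with values in pairs, whereas [qpower] sums over two
     functions. *)
  pose join (p : {ffun 'I_k -> 'I_I.1.+1} * {ffun 'I_k -> 'I_I.2.+1}) :
    {ffun 'I_k -> T} := [ffun r => (p.1 r, p.2 r)].
  pose split (g : {ffun 'I_k -> T}) := ([ffun r => (g r).1], [ffun r => (g r).2]).
  have joinK : cancel join split.
    by case=> a b; congr (_, _); apply/ffunP => r; rewrite !ffunE.
  have splitK : cancel split join.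
    by move=> g; apply/ffunP => r; rewrite !ffunE -surjective_pairing.
  rewrite (reindex join); last by exists split => p _.
  have j1 p r : (join p r).1 = p.1 r by rewrite ffunE.
  have j2 p r : (join p r).2 = p.2 r by rewrite ffunE.
  have s1 p : (\sum_r (join p r).1 = \sum_r p.1 r)%N.
    by apply: eq_bigr => r _; rewrite j1.
  have s2 p : (\sum_r (join p r).2 = \sum_r p.2 r)%N.
    by apply: eq_bigr => r _; rewrite j2.
  apply: eq_big => [p|p _].
    by rewrite eqI s1 s2.
  congr (q ^+ _ *: _); last by apply: eq_bigr => r _; rewrite j1 j2.
  apply: eq_bigr => r _; rewrite j1; congr (_ * _)%N.
  by apply: eq_bigr => s _; rewrite j2.
move=> A A1 A2; rewrite qseries_sumE /mono /qmono -big_mkcond.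
rewrite (big_pred1 (Ordinal (A1 : A.1 < I.1.+1)%N, Ordinal (A2 : A.2 < I.2.+1)%N)) /=.
  by rewrite -surjective_pairing.
by case: A A1 A2 => i j A1 A2 [a b]; rewrite /= !xpair_eqE -!val_eqE eq_sym
  [j == _]eq_sym.
Qed.

End PowerFormula.

(** * Universal properties of C_q^2, of M and of the algebra on the s_I and t_I *)

Section Lifts.
Variables (K : fieldType) (q : K) (B : algType K).

Lemma qplane_lift (x y : B) : y * x = q *: (x * y) ->
  exists h : {lrmorphism qplane q -> B}, h (px q) = x /\ h (py q) = y.
Proof.
move=> yx; have [|h hE] := @presalg_lift K bool (Relations (@qplane_proper K q)) B
    (fun c => if c then x else y).
  by move=> u v; apply: qplane_rel_map; rewrite /= !fevalE.
by exists h; rewrite /px /py !hE.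
Qed.

Lemma qplane_morph_eq (h h' : {lrmorphism qplane q -> B}) :
  h (px q) = h' (px q) -> h (py q) = h' (py q) -> h =1 h'.
Proof. by move=> ex ey; apply: presalg_morph_eq => -[]. Qed.

Lemma comeas_lift (t : idx -> idx -> B) :
  (forall I J L, qconv q (t^~ J) (t^~ L) I =
     q ^+ (J.2 * L.1) *: t I (addi J L)) ->
  t (0, 0)%N (0, 0)%N = 1 ->
  (forall I, I != (0, 0)%N -> t I (0, 0)%N = 0) ->
  exists h : {lrmorphism comeas q -> B}, forall I J, h (tC q I J) = t I J.
Proof.
move=> tM t1 t0.
have [|h hE] := @presalg_lift K _ (Relations (@comeas_proper K q)) B
    (fun c => t c.1 c.2); last by exists h => I J; apply: hE.
have E J : (fun A => feval (fun c => t c.1 c.2) (freegen K (A, J))) = t^~ J.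
  by apply/funext => A; rewrite fevalE.
move=> u v; apply: comeas_rel_map => [I J L||I I0] /=.
- by rewrite !E fevalE tM.
- by rewrite fevalE t1.
- by rewrite fevalE t0.
Qed.

Lemma stalg_lift (s t : idx -> B) :
  (forall I, q *: qconv q s t I = qconv q t s I) ->
  exists h : {lrmorphism stalg q -> B},
    (forall I, h (sS q I) = s I) /\ (forall I, h (tS q I) = t I).
Proof.
pose f (c : (idx + idx)%type) := match c with inl A => s A | inr A => t A end.
move=> st; have [|h hE] := @presalg_lift K _ (Relations (@st_proper K q)) B f.
  have Es : (fun A => feval f (freegen K (inl A))) = s.
    by apply/funext => A; rewrite fevalE.
  have Et : (fun A => feval f (freegen K (inr A))) = t.
    by apply/funext => A; rewrite fevalE.
  by move=> u v; apply: st_rel_map => I /=; rewrite Es Et st.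
by exists h; split=> I; apply: hE.
Qed.

Lemma stalg_morph_eq (h h' : {lrmorphism stalg q -> B}) :
  (forall I, h (sS q I) = h' (sS q I)) -> (forall I, h (tS q I) = h' (tS q I)) ->
  h =1 h'.
Proof. by move=> es et; apply: presalg_morph_eq => -[]. Qed.

End Lifts.

(** * Columns of the generating matrix and the presentation of M *)

Section Relations.
Variables (K : fieldType) (q : K).

Lemma tC_rel u v : comeas_rel q (fun I J => freegen K (I, J)) u v ->
  algpi (Relations (@comeas_proper K q)) u = algpi (Relations (@comeas_proper K q)) v.
Proof. exact: (@algpi_rel _ _ (Relations (@comeas_proper K q))). Qed.

Lemma tCE I J : tC q I J = algpi (Relations (@comeas_proper K q)) (freegen K (I, J)).
Proof. by rewrite /tC unlock. Qed.

Lemma tC_conv I J L : qconv q (tC q ^~ J) (tC q ^~ L) I =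
  q ^+ (J.2 * L.1) *: tC q I (addi J L).
Proof.
have E J' : tC q ^~ J' =
    fun A => algpi (Relations (@comeas_proper K q)) (freegen K (A, J')).
  by apply/funext => A; apply: tCE.
rewrite !E tCE -linearZ /= -(tC_rel (ComeasM _ _ I J L)).
by rewrite [RHS]qconv_map.
Qed.

Lemma tC1 : tC q (0, 0)%N (0, 0)%N = 1.
Proof. by rewrite tCE (tC_rel (Comeas1 _ _)) rmorph1. Qed.

Lemma tC0 I : I != (0, 0)%N -> tC q I (0, 0)%N = 0.
Proof. by move=> I0; rewrite tCE (tC_rel (Comeas0 _ _ I0)) raddf0. Qed.

Lemma st_comm I : q *: qconv q (sS q) (tS q) I = qconv q (tS q) (sS q) I.
Proof.
have Es : sS q = fun A => algpi (Relations (@st_proper K q)) (freegen K (inl A)).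
  by apply/funext => A; rewrite /sS unlock.
have Et : tS q = fun A => algpi (Relations (@st_proper K q)) (freegen K (inr A)).
  by apply/funext => A; rewrite /tS unlock.
rewrite Es Et -!qconv_map -linearZ.
by apply: (@algpi_rel _ _ (Relations (@st_proper K q))); apply: StComm.
Qed.

Lemma pyx : py q * px q = q *: (px q * py q).
Proof.
rewrite /px /py unlock -!rmorphM -linearZ.
by apply: (@algpi_rel _ _ (Relations (@qplane_proper K q))); apply: QPlane.
Qed.

Lemma peM J L : pe q J * pe q L = q ^+ (J.2 * L.1) *: pe q (addi J L).
Proof. exact: qcomm_monomialM pyx. Qed.

(** The type makes products and powers of columns those of twisted series. *)
Definition tcol (J : idx) : qseries (comeas q) q := tC q ^~ J.

Lemma tcolM J L : tcol J * tcol L = q ^+ (J.2 * L.1) *: tcol (addi J L).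
Proof. by apply/funext => I; apply: tC_conv. Qed.

Lemma tcol1 : tcol (0, 0)%N = 1.
Proof.
apply/funext => I; rewrite /tcol /GRing.one /= /qone /qmono.
by case: eqP => [->|/eqP/tC0 //]; apply: tC1.
Qed.

Lemma tC_monomial I J :
  tC q I J = (tcol (1, 0)%N ^+ J.1 * tcol (0, 1)%N ^+ J.2) I.
Proof. by rewrite -(family_monomial tcolM tcol1). Qed.

Lemma stalg_comeas_iso : exists phi : {lrmorphism stalg q -> comeas q},
  [/\ bijective phi, forall I, phi (sS q I) = tC q I (1, 0)%N
    & forall I, phi (tS q I) = tC q I (0, 1)%N].
Proof.
pose S : qseries (stalg q) q := sS q; pose T : qseries (stalg q) q := tS q.
(* The relations [st_rel] are the coefficients of this one identity. *)
have TS : T * S = q *: (S * T).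
  by apply/funext => I; rewrite -[LHS]/(qconv _ _ _ _) -st_comm.
have [phi [phis phit]] : exists h : {lrmorphism stalg q -> comeas q},
    (forall I, h (sS q I) = tcol (1, 0)%N I) /\
    (forall I, h (tS q I) = tcol (0, 1)%N I).
  apply: stalg_lift => I.
  exact: esym (congr1 (@^~ I) (family_qcomm tcolM)).
(* The inverse sends t^I_J to the coefficient at [I] of the monomial with exponents [J] in [S] and
   [T]; these monomials satisfy the comeasuring relations because [S] and [T] q-commute. *)
have [|||psi psiE] := @comeas_lift K q (stalg q)
    (fun I J => (S ^+ J.1 * T ^+ J.2) I).
- by move=> I J L; rewrite -[LHS]/((_ * _ : qseries _ _) I) (qcomm_monomialM _ _ TS).
- by rewrite !expr0 mulr1 /GRing.one /= /qone /qmono eqxx.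
- by move=> I /negbTE I0; rewrite !expr0 mulr1 /GRing.one /= /qone /qmono I0.
exists phi; split=> //; exists psi.
- apply: (@stalg_morph_eq K q _ (psi \o phi) idfun) => I /=.
    by rewrite phis psiE expr1 expr0 mulr1.
  by rewrite phit psiE expr1 expr0 mul1r.
(* Applied coefficientwise, [phi] carries monomials in [S] and [T] to the same monomials in the
   columns, whose coefficients are the t^I_J by [tC_monomial]. *)
- have es : (fun A => phi (S A)) = tcol (1, 0)%N by apply/funext.
  have et : (fun A => phi (T A)) = tcol (0, 1)%N by apply/funext.
  apply: (@presalg_morph_eq K _ (Relations (@comeas_proper K q)) _ (phi \o psi) idfun).
  case=> I J /=; rewrite -[presgen _ _]/(tC q I J) psiE qseries_map_monomial.
  by rewrite es et -tC_monomial.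
Qed.

(** Composition with the isomorphism leaves only the generators s_I and t_I to compare. *)
Lemma comeas_morph_eq (B : algType K) (h h' : {lrmorphism comeas q -> B}) :
  (forall I, h (tC q I (1, 0)%N) = h' (tC q I (1, 0)%N)) ->
  (forall I, h (tC q I (0, 1)%N) = h' (tC q I (0, 1)%N)) -> h =1 h'.
Proof.
have [phi [[psi _ psiK] phis phit]] := stalg_comeas_iso.
move=> es et x; rewrite -[x]psiK.
apply: (@stalg_morph_eq K q _ (h \o phi) (h' \o phi)) => I /=.
  by rewrite phis es.
by rewrite phit et.
Qed.

Lemma tC_qpower_x k I : tC q I (k, 0)%N = qpower q (tC q ^~ (1, 0)%N) k I.
Proof. by rewrite tC_monomial expr0 mulr1 qseries_expE. Qed.

Lemma tC_qpower_y k I : tC q I (0, k)%N = qpower q (tC q ^~ (0, 1)%N) k I.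
Proof. by rewrite tC_monomial expr0 mul1r qseries_expE. Qed.

End Relations.

(** * Bilinearity of pure tensors and components of formal sums *)

Section TensorLinear.
Variables (K : fieldType) (A B : algType K).
Implicit Types (a : A) (b : B).

Lemma pureDl a a' b : (a + a') \ox b = a \ox b + a' \ox b.
Proof. by rewrite /pure unlock -raddfD; apply/pure_rel/TensorDl. Qed.

Lemma pureDr a b b' : a \ox (b + b') = a \ox b + a \ox b'.
Proof. by rewrite /pure unlock -raddfD; apply/pure_rel/TensorDr. Qed.

Lemma pureZl k a b : (k *: a) \ox b = k *: (a \ox b).
Proof. by rewrite /pure unlock -linearZ; apply/pure_rel/TensorZl. Qed.

Lemma pureZr k a b : a \ox (k *: b) = k *: (a \ox b).
Proof. by rewrite /pure unlock -linearZ; apply/pure_rel/TensorZr. Qed.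

Lemma pure0l b : 0 \ox b = 0 :> tensor A B.
Proof. by rewrite -(scale0r 0) pureZl scale0r. Qed.

Lemma pure0r a : a \ox 0 = 0 :> tensor A B.
Proof. by rewrite -(scale0r 0) pureZr scale0r. Qed.

Lemma pure_suml (T : Type) (r : seq T) (f : T -> A) b :
  (\sum_(i <- r) f i) \ox b = \sum_(i <- r) f i \ox b.
Proof.
by elim: r => [|i r IH]; rewrite ?big_nil ?pure0l // !big_cons pureDl IH.
Qed.

Lemma pure_sumr (T : Type) (r : seq T) a (f : T -> B) :
  a \ox (\sum_(i <- r) f i) = \sum_(i <- r) a \ox f i.
Proof.
by elim: r => [|i r IH]; rewrite ?big_nil ?pure0r // !big_cons pureDr IH.
Qed.

End TensorLinear.

Lemma component_sum (K : fieldType) (T : algType K) (D : grading T) (J : Type)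
  (r : seq J) (f : J -> completion D) N :
  (\sum_(i <- r) f i) N = \sum_(i <- r) f i N.
Proof. by elim/big_ind2: _ => // u y v z <- <-. Qed.

Lemma sums_to_uniq (K : fieldType) (T : algType K) (D : grading T)
  (f : idx -> T) (z z' : completion D) : sums_to f z -> sums_to f z' -> z = z'.
Proof. by move=> fz fz'; apply: completionP => N; rewrite fz fz'. Qed.

Lemma addi_sub (N : idx) (a : 'I_N.1.+1) (b : 'I_N.2.+1) :
  addi (a : nat, b : nat) (N.1 - a, N.2 - b)%N = N.
Proof. by case: N a b => i j a b; rewrite /addi /= !subnKC // -ltnS. Qed.

(** * The coaction *)

Section Coaction.
Variables (K : fieldType) (q : K).

Lemma pe_homogeneous I : qplane_grading q I (pe q I).
Proof.
apply: lspan_gen; exists (nseq I.1 true ++ nseq I.2 false).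
  case: I => i j; rewrite /weight !big_cat !big_nseq /=.
  by rewrite !iter_addn !mul0n !mul1n !addn0 add0n.
by rewrite /pe big_cat !big_nseq !iter_mulr_1.
Qed.

Lemma tC_homogeneous I J : comeas_grading q I (tC q I J).
Proof.
apply: lspan_gen; exists [:: (I, J)]; last by rewrite big_seq1.
by rewrite /weight !big_seq1; case: I.
Qed.

Lemma coaction_term_in J I : grading_l (comeas q) (qplane_grading q) I
  (pe q I \ox tC q I J).
Proof.
apply: lspan_gen; exists (pe q I), (tC q I J); split=> //.
exact: pe_homogeneous.
Qed.

Definition coaction_basis J : qplane_comeas q := FormalSum (coaction_term_in J).

(** In degree [N] the product of the left factors e_I supplies the power of [q] that turns the
    Cauchy product into the convolution of two columns. *)
Lemma coaction_basisM J L : coaction_basis J * coaction_basis L =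
  q ^+ (J.2 * L.1) *: coaction_basis (addi J L).
Proof.
apply: completionP => N; rewrite [RHS]/= -pureZr -tC_conv /qconv pure_sumr.
apply: eq_bigr => a _; rewrite pure_sumr; apply: eq_bigr => b _ /=.
rewrite [LHS]pureM [RHS]pureZr.
have e := peM q (a : nat, b : nat) (N.1 - a, N.2 - b)%N.
by rewrite addi_sub in e; rewrite e; apply: pureZl.
Qed.

Lemma coaction_basis1 : coaction_basis (0, 0)%N = 1.
Proof.
apply: completionP => N; rewrite /=; case: eqP => [->|/eqP N0].
  by rewrite tC1 /pe !expr0 mulr1 pure1.
by rewrite tC0 // pure0r.
Qed.

Lemma coaction_exists : exists delta : {lrmorphism qplane q -> qplane_comeas q},
  forall J, sums_to (fun I => pe q I \ox tC q I J) (delta (pe q J)).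
Proof.
(* The intended images of x and y q-commute; the images of all other e_J are then forced, being
   monomials in these two. *)
have [delta [dx dy]] := qplane_lift (family_qcomm coaction_basisM).
exists delta => J; suff -> : delta (pe q J) = coaction_basis J by [].
rewrite [LHS]rmorphM [X in X * _]rmorphXn [X in _ * X]rmorphXn /= dx dy.
exact: esym (family_monomial coaction_basisM coaction_basis1 J).
Qed.

(** * The coproduct and the counit *)

Lemma coproduct_term_in I J L : grading_r (comeas q) (comeas_grading q) L
  (tC q I L \ox tC q L J).
Proof.
apply: lspan_gen; exists (tC q I L), (tC q L J); split=> //.
exact: tC_homogeneous.
Qed.

Definition coproduct_gen I J : comeas_comeas q :=
  FormalSum (coproduct_term_in I J).

(** The comeasuring relation is used twice in each degree [N]: contracting the left tensor factors,
    for a fixed splitting of [N], produces exactly the power of [q] needed to contract the right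
    ones. *)
Lemma coproduct_genM I J L :
  qconv q (coproduct_gen ^~ J) (coproduct_gen ^~ L) I =
  q ^+ (J.2 * L.1) *: coproduct_gen I (addi J L).
Proof.
apply: completionP => N; rewrite [RHS]/= -pureZr -tC_conv /qconv pure_sumr.
(* The splittings of [N], from the Cauchy product, are moved outside the splittings of [I], from the
   convolution. *)
transitivity (\sum_(c < N.1.+1) \sum_(d < N.2.+1)
   qconv q (tC q ^~ (c : nat, d : nat)) (tC q ^~ (N.1 - c, N.2 - d)%N) I
     \ox (tC q (c : nat, d : nat) J * tC q (N.1 - c, N.2 - d)%N L)).
  rewrite component_sum.
  under [LHS]eq_bigr => a _.
    rewrite component_sum.
    under eq_bigr => b _ do rewrite /= /cauchy scaler_sumr.
    rewrite exchange_big; over.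
  rewrite exchange_big; apply: eq_bigr => c _ /=.
  under eq_bigr => a _ do under eq_bigr => b _ do rewrite scaler_sumr.
  under [LHS]eq_bigr => a _ do rewrite exchange_big.
  rewrite exchange_big; apply: eq_bigr => d _ /=.
  rewrite /qconv pure_suml; apply: eq_bigr => a _.
  rewrite pure_suml; apply: eq_bigr => b _.
  by rewrite [RHS]pureZl; congr (_ *: _); apply: pureM.
apply: eq_bigr => c _; rewrite pure_sumr; apply: eq_bigr => d _.
rewrite tC_conv [LHS]pureZl [RHS]pureZr.
by rewrite addi_sub.
Qed.

Lemma coproduct_gen1 : coproduct_gen (0, 0)%N (0, 0)%N = 1.
Proof.
apply: completionP => N; rewrite /=; case: eqP => [->|/eqP N0].
  by rewrite tC1 pure1.
by rewrite (tC0 q N0) pure0r.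
Qed.

(** The left tensor factor vanishes in degree [(0, 0)], the right one in every other degree. *)
Lemma coproduct_gen0 I : I != (0, 0)%N -> coproduct_gen I (0, 0)%N = 0.
Proof.
move=> I0; apply: completionP => N /=; case: (N =P (0, 0)%N) => [->|/eqP N0].
  by rewrite (tC0 q I0) pure0l.
by rewrite (tC0 q N0) pure0r.
Qed.

Lemma coproduct_exists : exists Delta : {lrmorphism comeas q -> comeas_comeas q},
  forall I J, sums_to (fun L => tC q I L \ox tC q L J) (Delta (tC q I J)).
Proof.
have [Delta DE] := comeas_lift coproduct_genM coproduct_gen1 coproduct_gen0.
by exists Delta => I J; rewrite DE.
Qed.

(** The identity matrix satisfies the comeasuring relations, by [qconv_delta]. *)
Lemma counit_exists : exists eps : {lrmorphism comeas q -> K^o},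
  forall I J, eps (tC q I J) = (I == J)%:R.
Proof.
apply: (@comeas_lift K q K^o (fun I J => (I == J)%:R)) => //.
  by move=> I J L; apply: qconv_delta.
by move=> I /negbTE ->.
Qed.

End Coaction.

Theorem proposition3p1 (R : realType) (q : R[i]) (hq : q != 0) :
  let t : idx -> idx -> comeas q := tC q in
  let sM (I : idx) : comeas q := t I (1, 0)%N in
  let tM (I : idx) : comeas q := t I (0, 1)%N in
  [/\ (* M is presented by the s_I, t_I and the relations st_rel *)
      exists phi : {lrmorphism stalg q -> comeas q},
        [/\ bijective phi,
            forall I, phi (sS q I) = sM I
          & forall I, phi (tS q I) = tM I],
      (* the coaction *)
      exists delta : {lrmorphism qplane q -> qplane_comeas q},
        [/\ forall J, sums_to (fun I => pe q I \ox t I J) (delta (pe q J)),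
            sums_to (fun I => (px q ^+ I.1 * py q ^+ I.2) \ox sM I)
              (delta (px q)),
            sums_to (fun I => (px q ^+ I.1 * py q ^+ I.2) \ox tM I)
              (delta (py q))
          & forall delta' : {lrmorphism qplane q -> qplane_comeas q},
              sums_to (fun I => (px q ^+ I.1 * py q ^+ I.2) \ox sM I)
                (delta' (px q)) ->
              sums_to (fun I => (px q ^+ I.1 * py q ^+ I.2) \ox tM I)
                (delta' (py q)) ->
              delta' =1 delta],
      (* the higher generators *)
      [/\ forall (k : nat) (I : idx), (1 <= k)%N ->
            t I (k, 0)%N = qpower q sM k I,
          forall (k : nat) (I : idx), (1 <= k)%N ->
            t I (0, k)%N = qpower q tM k I
        & forall (k l : nat) (I : idx), (1 <= k)%N -> (1 <= l)%N ->
            t I (k, l) = qconv q (fun A => t A (k, 0)%N)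
                                 (fun A => t A (0, l)%N) I],
      (* the coproduct *)
      exists Delta : {lrmorphism comeas q -> comeas_comeas q},
        [/\ forall I J, sums_to (fun L => t I L \ox t L J) (Delta (t I J)),
            forall I, sums_to (fun L => t I L \ox sM L) (Delta (sM I)),
            forall I, sums_to (fun L => t I L \ox tM L) (Delta (tM I))
          & forall Delta' : {lrmorphism comeas q -> comeas_comeas q},
              (forall I, sums_to (fun L => t I L \ox sM L) (Delta' (sM I))) ->
              (forall I, sums_to (fun L => t I L \ox tM L) (Delta' (tM I))) ->
              Delta' =1 Delta]
    & (* the counit *)
      exists eps : {lrmorphism comeas q -> R[i]^o},
        [/\ forall I J, eps (t I J) = (I == J)%:R,
            forall i j, eps (sM (i, j)) = ((i == 1%N) && (j == 0%N))%:R,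
            forall i j, eps (tM (i, j)) = ((i == 0%N) && (j == 1%N))%:R
          & forall eps' : {lrmorphism comeas q -> R[i]^o},
              (forall i j, eps' (sM (i, j)) = ((i == 1%N) && (j == 0%N))%:R) ->
              (forall i j, eps' (tM (i, j)) = ((i == 0%N) && (j == 1%N))%:R) ->
              eps' =1 eps]].
Proof.
move=> t sM tM; split.
- exact: stalg_comeas_iso.
- have [delta deltaE] := coaction_exists q.
  have ex : pe q (1, 0)%N = px q by rewrite /pe expr1 expr0 mulr1.
  have ey : pe q (0, 1)%N = py q by rewrite /pe expr1 expr0 mul1r.
  have dx := deltaE (1, 0)%N; have dy := deltaE (0, 1)%N.
  rewrite ex in dx; rewrite ey in dy.
  (* Uniqueness: x and y generate C_q^2, and a formal sum is determined by its components. *)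
  exists delta; split=> // delta' dx' dy'; apply: qplane_morph_eq.
    exact: sums_to_uniq dx' dx.
  exact: sums_to_uniq dy' dy.
- split=> [k I _|k I _|k l I _ _]; first exact: tC_qpower_x.
    exact: tC_qpower_y.
  (* For lower indices [(k, 0)] and [(0, l)] the comeasuring relation carries the power [q ^+ 0]. *)
  by rewrite tC_conv mul0n expr0 scale1r /addi /= addn0.
- have [Delta DeltaE] := coproduct_exists q.
  exists Delta; split=> [//|I|I|Delta' Ds Dt]; [exact: DeltaE..|].
  apply: comeas_morph_eq => I.
    exact: sums_to_uniq (Ds I) (DeltaE _ _).
  exact: sums_to_uniq (Dt I) (DeltaE _ _).
- have [eps epsE] := counit_exists q.
  exists eps; split=> [//|i j|i j|eps' es et]; [by rewrite epsE..|].
  by apply: comeas_morph_eq => -[i j]; rewrite epsE ?es ?et.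
Qed.
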